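(* Let $N\geq 2$ and $k\in\{1,\dots,N-1\}$. Let $f:\mathbb R\to\mathbb R$ be a function for which there exists $\delta>0$ such that $f\in C^1((-\delta,\delta))$, $f$ is nondecreasing in $(-\delta,\delta)$, $f(u)>0$ for all $u\in(0,\delta)$, and $f(0)=0$. Then there exist infinitely many positive and bounded radial classical solutions $u$ of $$\mathcal{P}^-_{k}(D^2u)+f(u)=0\quad\text{in }\mathbb R^N.$$
   Context: For a real symmetric $N\times N$ matrix $X$ with ordered eigenvalues $\lambda_1(X)\leq\dots\leq\lambda_N(X)$, the truncated Laplacian is $\mathcal{P}^-_{k}(X)=\lambda_1(X)+\dots+\lambda_k(X)$. A classical solution is a function $u\in C^2(\mathbb R^N)$ satisfying the equation pointwise in $\mathbb R^N$; radial means $u(x)$ depends only on $|x|$; positive means $u>0$ everywhere in $\mathbb R^N$. *)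

(* Defs.v *)
From mathcomp Require Import all_boot all_order all_algebra.
From mathcomp Require Import complex.
From mathcomp Require Import all_classical all_reals all_analysis.

Set Implicit Arguments.
Unset Strict Implicit.
Unset Printing Implicit Defensive.

Import Order.TTheory GRing.Theory Num.Theory.
Import numFieldNormedType.Exports.

Local Open Scope classical_set_scope.
Local Open Scope ring_scope.

Definition is_ordered_spectrum (R : realType) (n : nat) (X : 'M[R]_n)
    (s : seq R) : Prop :=
  sorted <=%R s /\ char_poly X = \prod_(l <- s) ('X - l%:P).

(* Eigenvalues in nondecreasing order, repeated with multiplicity, so that
   lambda_i is (eigenvalues X)`_(i - 1). The default value [::] is never used
   when X is symmetric, see eigenvaluesP. *)
Definition eigenvalues (R : realType) (n : nat) (X : 'M[R]_n) : seq R :=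
  xget [::] [set s | is_ordered_spectrum X s].

Lemma size_ordered_spectrum (R : realType) (n : nat) (X : 'M[R]_n) s :
  is_ordered_spectrum X s -> size s = n.
Proof.
move=> [_ Xs]; have := size_char_poly X.
by rewrite Xs size_prod_XsubC => -[].
Qed.

Lemma ordered_spectrum_unique (R : realType) (n : nat) (X : 'M[R]_n) s t :
  is_ordered_spectrum X s -> is_ordered_spectrum X t -> s = t.
Proof.
move=> [ss Xs] [st Xt]; apply: (sorted_eq le_trans le_anti) => //.
by apply: prod_XsubC_eq; rewrite -Xs.
Qed.

Lemma ordered_spectrum_exists (R : realType) (n : nat) (X : 'M[R]_n) :
  X^T = X -> exists s, is_ordered_spectrum X s.
Proof.
move=> Xsym; pose toC := real_complex R.
pose A : 'M[R[i]]_n := map_mx toC X.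
have Asym : A \is symmetricmx.
  by apply/is_hermitianmxP; rewrite expr0 scale1r map_mx_id// /A map_trmx Xsym.
have Areal : A \is a realmx.
  by apply/mxOverP => i j; rewrite mxE complex_real.
have Aherm := realsym_hermsym Asym Areal.
have /mxOverP Dreal := hermitian_spectral_diag_real Aherm.
have /orthomx_spectralP := hermitian_normalmx Aherm.
set P := spectralmx A; set D := spectral_diag A => AE.
have Pu : P \in unitmx by exact: spectral_unit.
pose r := [seq complex.Re (D 0 i) | i <- enum 'I_n].
have charA : char_poly A = \prod_(i < n) ('X - (D 0 i)%:P).
  have PP : map_mx polyC P *m map_mx polyC (invmx P) = 1%:M :> 'M[{poly R[i]}]_n.
    by rewrite -map_mxM mulmxV// map_mx1.
  have PP' : map_mx polyC (invmx P) *m map_mx polyC P = 1%:M :> 'M[{poly R[i]}]_n.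
    by rewrite -map_mxM mulVmx// map_mx1.
  have -> : char_poly A = char_poly (diag_mx D).
    rewrite /char_poly /char_poly_mx.
    have -> : 'X%:M - map_mx polyC A = map_mx polyC (invmx P) *m
        ('X%:M - map_mx polyC (diag_mx D)) *m map_mx polyC P.
      rewrite mulmxBr mulmxBl -!map_mxM -AE scalar_mxC -mulmxA PP'.
      by rewrite mulmx1.
    by rewrite !det_mulmx mulrAC -det_mulmx PP' det1 mul1r.
  rewrite char_poly_trig ?diag_mx_is_trig//.
  by apply: eq_bigr => i _; rewrite mxE eqxx mulr1n.
have charX : char_poly X = \prod_(l <- r) ('X - l%:P).
  apply: (map_poly_inj toC); rewrite map_char_poly -/A charA.
  rewrite map_prod_XsubC big_map big_enum; apply: eq_bigr => i _ /=.
  by rewrite /toC RRe_real.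
exists (sort <=%R r); split; first exact: (sort_sorted le_total).
by rewrite charX; apply: perm_big; rewrite perm_sym perm_sort.
Qed.

Lemma eigenvaluesP (R : realType) (n : nat) (X : 'M[R]_n) :
  X^T = X -> is_ordered_spectrum X (eigenvalues X).
Proof.
by move=> /ordered_spectrum_exists[s Xs]; exact: (xgetPex [::] (ex_intro _ s Xs)).
Qed.

Definition truncated_laplacian (R : realType) (n k : nat) (X : 'M[R]_n) : R :=
  \sum_(i < k) (eigenvalues X)`_i.

Definition partial (R : realType) (n : nat) (i : 'I_n) (u : 'rV[R]_n -> R) :
    'rV[R]_n -> R :=
  'D_(delta_mx 0 i) u.

Definition is_C1 (R : realType) (n : nat) (u : 'rV[R]_n -> R) : Prop :=
  forall i : 'I_n,
    (forall x, derivable u x (delta_mx 0 i)) /\ continuous (partial i u).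

Definition is_C2 (R : realType) (n : nat) (u : 'rV[R]_n -> R) : Prop :=
  is_C1 u /\ forall i : 'I_n, is_C1 (partial i u).

Definition hessian (R : realType) (n : nat) (u : 'rV[R]_n -> R)
    (x : 'rV[R]_n) : 'M[R]_n :=
  \matrix_(i, j) partial i (partial j u) x.

Definition is_classical_solution (R : realType) (n k : nat) (f : R -> R)
    (u : 'rV[R]_n -> R) : Prop :=
  is_C2 u /\ forall x, truncated_laplacian k (hessian u x) + f (u x) = 0.

(* The norm `|x| of 'rV[R]_n is the max norm, hence a separate definition. *)
Definition euclidean_norm (R : realType) (n : nat) (x : 'rV[R]_n) : R :=
  Num.sqrt (\sum_i x 0 i ^+ 2).

Definition is_radial (R : realType) (n : nat) (u : 'rV[R]_n -> R) : Prop :=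
  exists g : R -> R, forall x, u x = g (euclidean_norm x).

Definition is_bounded (T : Type) (R : realType) (u : T -> R) : Prop :=
  exists M : R, forall x, `|u x| <= M.

(* Main.v *)
(* Look for u(x) = h(|x|^2 / 2). The Hessian is h' I + h'' x^T x, with eigenvalues
   h' (N - 1 times) and h' + h'' |x|^2; when h'' >= 0 the k <= N - 1 smallest ones
   are all equal to h', and the equation reduces to the autonomous first-order
   problem h' = - f(h) / k. This is consistent, since then
   h'' = f'(h) f(h) / k^2 >= 0 as f is nondecreasing. As f is at most linear near
   0 = f(0), h stays positive forever, and its time translates give infinitely
   many solutions. *)

Require Import Defs.
From mathcomp Require Import all_boot all_order all_algebra.
From mathcomp Require Import all_classical all_reals all_analysis.
From mathcomp Require Import ring lra.

Import Order.TTheory GRing.Theory Num.Theory.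
Import numFieldNormedType.Exports.

Local Open Scope classical_set_scope.
Local Open Scope ring_scope.

Set Implicit Arguments.
Unset Strict Implicit.
Unset Printing Implicit Defensive.

(** * Spectrum of a scalar matrix plus a rank-one matrix *)

(** Matrix determinant lemma, multiplied by [y] so that neither an inverse of [y] nor the exponent
    [n - 1] occurs. *)
Lemma det_scalar_sub_rank1 (D : idomainType) (n : nat) (y : D) (u : 'cV[D]_n)
    (v : 'rV[D]_n) :
  \det (y%:M - u *m v) * y = (y - (v *m u) 0 0) * y ^+ n.
Proof.
(* Multiplying B by a block triangular matrix can clear either off-diagonal block. *)
pose B : 'M[D]_(1 + n) := block_mx 1%:M v u y%:M.
have <- : \det B = \det (y%:M - u *m v).
  have <- : \det (B *m block_mx 1%:M (- v) 0 1%:M) = \det B.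
    by rewrite det_mulmx det_ublock !det1 !mulr1.
  rewrite mulmx_block !mul1mx !mulmx1 !mulmx0 !addr0 addNr mulmxN det_lblock det1.
  by rewrite mul1r addrC.
have -> : \det B * y = \det (B *m block_mx y%:M 0 (- u) 1%:M).
  by rewrite det_mulmx det_lblock det1 mulr1 det_scalar1.
rewrite mulmx_block !mul1mx !mulmx1 !mulmx0 !add0r mulmxN scalar_mxC.
by rewrite mulmxN subrr det_ublock det_scalar [_ - _]mx11_scalar det_scalar1 !mxE eqxx mulr1n.
Qed.

(** The determinant identity over [{poly R}] with [y = 'X - a%:P], a nonzero polynomial that can
    then be cancelled. *)
Lemma char_poly_scalar_rank1 (R : realType) (n : nat) (a b : R) (x : 'rV[R]_n.+1) :
  char_poly (a%:M + b *: (x^T *m x)) =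
  ('X - a%:P) ^+ n * ('X - (a + b * \sum_i x 0 i ^+ 2)%:P).
Proof.
have y0 : 'X - a%:P != 0 :> {poly R} by rewrite polyXsubC_eq0.
apply: (mulIf y0); rewrite mulrAC -exprSr.
pose u : 'cV[{poly R}]_n.+1 := b%:P *: map_mx polyC x^T.
have -> : char_poly (a%:M + b *: (x^T *m x)) =
    \det (('X - a%:P)%:M - u *m map_mx polyC x).
  rewrite /char_poly /char_poly_mx map_mxD map_scalar_mx/= map_mxZ map_mxM/=.
  by rewrite opprD addrA -scalemxAl raddfB.
rewrite det_scalar_sub_rank1 mulrC; congr (_ * _).
rewrite polyCD opprD addrA; congr (_ - _).
rewrite !mxE polyCM rmorph_sum/= mulr_sumr; apply: eq_bigr => i _.
by rewrite !mxE rmorphXn/= expr2 mulrCA.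
Qed.

(** As [0 <= b], the exceptional eigenvalue [a + b * |x|^2] is the largest and comes last in the
    ordered spectrum; [k < n] leaves it out of the sum. *)
Lemma truncated_laplacian_scalar_rank1 (R : realType) (n k : nat) (a b : R)
    (x : 'rV[R]_n) : (k < n)%N -> 0 <= b ->
  truncated_laplacian k (a%:M + b *: (x^T *m x)) = k%:R * a.
Proof.
case: n x => // n x kn b0.
have c0 : 0 <= b * \sum_i x 0 i ^+ 2 by rewrite mulr_ge0// sumr_ge0// => i _; rewrite sqr_ge0.
set c := _ * _ in c0.
pose s := rcons (nseq n a) (a + c).
set X := a%:M + _.
have Xs : is_ordered_spectrum X s.
  split.
    rewrite /s; case: (n) => //= m.
    by elim: m => [|m IHm] /=; rewrite ?lexx// andbT lerDl.
  rewrite char_poly_scalar_rank1 -/c /s -cats1 big_cat/= big_nseq iter_mulr_1.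
  by rewrite big_seq1.
have Xsym : X^T = X by rewrite /X linearD/= tr_scalar_mx linearZ/= trmx_mul trmxK.
rewrite /truncated_laplacian (ordered_spectrum_unique (eigenvaluesP Xsym) Xs).
rewrite (eq_bigr (fun=> a)) => [|i _]; first by rewrite sumr_const card_ord mulr_natl.
have iln : (i < n)%N by rewrite (leq_trans (ltn_ord i)).
by rewrite nth_rcons size_nseq iln nth_nseq iln.
Qed.

(** * Differentiation of radial functions *)

(** Unlike the norm, this radial variable is smooth at the origin; with the factor 1/2 its gradient
    is [x]. *)
Definition half_sqnorm (R : realType) (n : nat) (x : 'rV[R]_n) : R :=
  (\sum_j x 0 j ^+ 2) / 2.

Lemma half_sqnorm_ge0 (R : realType) (n : nat) (x : 'rV[R]_n) : 0 <= half_sqnorm x.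
Proof. by rewrite divr_ge0// sumr_ge0// => j _; exact: sqr_ge0. Qed.

Lemma continuous_half_sqnorm (R : realType) (n : nat) :
  continuous (@half_sqnorm R n).
Proof.
move=> x; apply: (@continuousM R 'rV[R]_n (fun y => \sum_j y 0 j ^+ 2) (fun=> 2^-1));
  last exact: cst_continuous.
pose F j (y : 'rV[R]_n) := y 0 j ^+ 2.
apply: (@continuous_big R _ _ 0 xpredT _ _ _ F) => [|j _]; first exact: add_continuous.
by move=> y; apply: (@continuousM R 'rV[R]_n (fun y => y 0 j) (fun y => y 0 j));
  exact: coord_continuous.
Qed.

(** Reduces directional derivatives to derivatives in one real variable, where the chain rule
    [is_derive1_comp] applies. *)
Lemma is_derive_line (R : realType) (V : normedModType R) (f : V -> R) (x v : V)
    (d : R) :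
  is_derive (0 : R) 1 (fun t : R => f (t *: v + x)) d -> is_derive x v f d.
Proof.
move=> fd; apply: DeriveDef; first by apply/derivable1P; case: fd.
rewrite -[RHS](@derive_val _ _ _ _ _ _ _ fd) /derive.
by apply: congr1; apply: congr2 => //; apply/funext => t /=;
  rewrite [t%:A]mulr1 addr0 scale0r add0r.
Qed.

Lemma is_derive_comp_half_sqnorm (R : realType) (n : nat) (i : 'I_n) (h : R -> R) (dh : R)
    (x : 'rV[R]_n) :
  is_derive (half_sqnorm x) 1 h dh ->
  is_derive x (delta_mx 0 i) (fun y : 'rV[R]_n => h (half_sqnorm y))
    (dh * x 0 i).
Proof.
(* On the line through [x] in the [i]-th direction, [half_sqnorm] is this quadratic polynomial in
   [t]. *)
move=> dh'; pose p (t : R) := half_sqnorm x + (t * x 0 i + t ^+ 2 / 2).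
have E (t : R) : half_sqnorm (t *: delta_mx 0 i + x) = p t.
  rewrite /p /half_sqnorm (bigD1 i)//= [in RHS](bigD1 i)//=.
  under eq_bigr => j ji do rewrite !mxE (negbTE ji) /= mulr0 add0r.
  by rewrite !mxE !eqxx/=; field.
have dp : is_derive (0 : R) 1 p (x 0 i).
  apply: is_derive_eq.
  by rewrite !(scaler0, scale0r, add0r, addr0, mul1r) [_%:A]mulr1.
have p0 : p 0 = half_sqnorm x by rewrite /p expr0n/= !mul0r !addr0.
rewrite -p0 in dh'.
have dhp : is_derive (0:R) 1 (h \o p) (dh * x 0 i) by exact: is_derive1_comp.
apply: is_derive_line.
suff -> : (fun t : R => h (half_sqnorm (t *: delta_mx 0 i + x))) = h \o p by [].
by apply/funext => t /=; rewrite E.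
Qed.

Section radial_C2.
Variables (R : realType) (n : nat) (h h1 h2 : R -> R).
(** The derivative at [s = 0] is two-sided, which suits profiles shifted in time to start at a
    positive instant. *)
Hypothesis dh : forall s : R, 0 <= s -> is_derive s 1 h (h1 s).
Hypothesis dh1 : forall s : R, 0 <= s -> is_derive s 1 h1 (h2 s).

Local Notation u := (fun x : 'rV[R]_n => h (half_sqnorm x)).

Lemma partial_comp_half_sqnorm i :
  partial i u = fun x : 'rV[R]_n => h1 (half_sqnorm x) * x 0 i.
Proof.
apply/funext => x; have := is_derive_comp_half_sqnorm i (dh (half_sqnorm_ge0 x)).
by move=> d; rewrite /partial derive_val.
Qed.

Lemma is_derive_partial_comp_half_sqnorm i j (x : 'rV[R]_n) :
  is_derive x (delta_mx 0 i) (partial j u)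
    (h2 (half_sqnorm x) * x 0 i * x 0 j + h1 (half_sqnorm x) * (i == j)%:R).
Proof.
rewrite partial_comp_half_sqnorm.
have d1 := is_derive_comp_half_sqnorm i (dh1 (half_sqnorm_ge0 x)).
have d2 : is_derive x (delta_mx 0 i) (fun y : 'rV[R]_n => y 0 j) (i == j)%:R.
  apply: is_derive_line.
  suff -> : (fun t : R => (t *: delta_mx 0 i + x) 0 j) = fun t => t * (i == j)%:R + x 0 j.
    by apply: is_derive_eq; rewrite scaler0 add0r addr0 [_%:A]mulr1.
  by apply/funext => t; rewrite !mxE eqxx eq_sym.
by apply: is_derive_eq; rewrite addrC; congr (_ + _); rewrite [LHS]mulrC.
Qed.

Lemma hessian_comp_half_sqnorm (x : 'rV[R]_n) :
  hessian u x = (h1 (half_sqnorm x))%:M + h2 (half_sqnorm x) *: (x^T *m x).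
Proof.
apply/matrixP => i j; have := is_derive_partial_comp_half_sqnorm i j x.
move=> d; rewrite !mxE /partial derive_val big_ord1 !mxE addrC mulrA.
by rewrite mulr_natr.
Qed.

Lemma is_C2_comp_half_sqnorm :
  (forall s : R, 0 <= s -> {for s, continuous h2}) -> is_C2 u.
Proof.
move=> ch2; have derc (g dg : R -> R) : (forall s : R, 0 <= s -> is_derive s 1 g (dg s)) ->
    forall s : R, 0 <= s -> {for s, continuous g}.
  move=> dgP s s0; apply: differentiable_continuous; apply/derivable1_diffP.
  by have [] := dgP s s0.
have cc g : (forall s : R, 0 <= s -> {for s, continuous g}) ->
    continuous (fun x : 'rV[R]_n => g (half_sqnorm x) : R).
  move=> cg x; apply: continuous_comp; first exact: continuous_half_sqnorm.
  by apply: cg; exact: half_sqnorm_ge0.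
have cch1 := cc _ (derc _ _ dh1).
split=> [i|i l]; split.
- by move=> x; have [] := is_derive_comp_half_sqnorm i (dh (half_sqnorm_ge0 x)).
- rewrite partial_comp_half_sqnorm => x.
  by apply: (@continuousM R 'rV[R]_n); [exact: cch1|exact: coord_continuous].
- by move=> x; have [] := is_derive_partial_comp_half_sqnorm l i x.
- have -> : partial l (partial i u) = fun x : 'rV[R]_n =>
     h2 (half_sqnorm x) * x 0 l * x 0 i + h1 (half_sqnorm x) * (l == i)%:R.
    apply/funext => x; have := is_derive_partial_comp_half_sqnorm l i x.
    by move=> d; rewrite /partial derive_val.
  move=> x; apply: (@continuousD R R 'rV[R]_n); apply: (@continuousM R 'rV[R]_n).
  + by apply: (@continuousM R 'rV[R]_n); [exact: cc|exact: coord_continuous].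
  + exact: coord_continuous.
  + exact: cch1.
  + exact: cst_continuous.
Qed.
End radial_C2.

(** * The profile as a solution of an autonomous differential equation *)

(** Integrate from -1. For [z < 0] both [q] and the integral vanish near [z]; for [0 <= z] the point
    is interior to the half-line of integration and the fundamental theorem of calculus applies. *)
Lemma antiderivative_right (R : realType) (q : R -> R) :
  continuous q -> (forall z, z <= 0 -> q z = 0) ->
  exists Q : R -> R, forall z : R, is_derive z 1 Q (q z).
Proof.
move=> cq q0; pose mu := @lebesgue_measure R.
pose Q z := (\int[mu]_(t in [set` Interval (BLeft (- 1)) (BRight z)]) q t)%R.
have Q0 z : z <= 0 -> Q z = 0.
  move=> z0; rewrite /Q (@eq_Rintegral _ _ _ _ _ (cst 0)) ?Rintegral_cst//=; last first.
    by move=> t; rewrite inE/= in_itv/= => /andP[_ tz]; apply: q0; exact: le_trans tz z0.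
  by rewrite mul0r.
exists Q => z; have [z0|z0] := ltP z 0.
  rewrite q0 ?ltW//.
  apply: (near_eq_is_derive (f := cst 0)) => //.
  near=> t; rewrite Q0//; apply: ltW; near: t; exact: lt_nbhsl.
have zz : z < z + 1 by rewrite ltrDl.
have [//|||dQ <-] := @continuous_FTC1 R q (BLeft (- 1)) z (z + 1) zz.
- apply: continuous_compact_integrable; first exact: segment_compact.
  exact: continuous_subspaceT.
- by rewrite lte_fin (lt_le_trans _ z0)// ltrN10.
- exact: cq.
by rewrite derive1E; apply: DeriveDef.
Unshelve. all: by end_near.
Qed.

Lemma antiderivative (R : realType) (q : R -> R) : continuous q ->
  exists Q : R -> R, forall z : R, is_derive z 1 Q (q z).
Proof.
move=> cq.
have cm : continuous (fun z : R => Num.max z 0).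
  by move=> z; apply: continuous_max => //; exact: cst_continuous.
have [F dF] : exists Q : R -> R, forall z : R, is_derive z 1 Q (q (Num.max z 0) - q 0).
  apply: antiderivative_right => [z|z z0]; last by rewrite (max_idPr z0) subrr.
  apply: continuousB; last exact: cst_continuous.
  apply: continuous_comp; [exact: cm|exact: cq].
have [G dG] : exists Q : R -> R, forall z : R, is_derive z 1 Q (q (- Num.max z 0) - q 0).
  apply: antiderivative_right => [z|z z0]; last by rewrite (max_idPr z0) oppr0 subrr.
  apply: continuousB; last exact: cst_continuous.
  apply: (continuous_comp (g := q)); last exact: cq.
  by apply: continuousN; exact: cm.
(* The integral only gives a primitive on a half-line, hence the splitting of q
   as q (max z 0) + q (min z 0) - q 0. *)
exists (fun z => q 0 * z + F z - G (- z)) => z.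
have dGN : is_derive z 1 (G \o -%R) ((q (- Num.max (- z) 0) - q 0) * - 1).
  exact: is_derive1_comp.
have -> : q z = q 0 *: 1 + (q (Num.max z 0) - q 0) - ((q (- Num.max (- z) 0) - q 0) * - 1).
  rewrite [_ *: _]mulr1; have [z0|z0] := leP 0 z.
    by rewrite (max_idPr _) ?oppr_le0// oppr0; ring.
  by rewrite (max_idPl _) ?oppr_ge0 ?ltW// opprK; ring.
by apply: is_deriveB; apply: is_deriveD.
Qed.

(** Separation of variables: [P] is the inverse of an antiderivative [Q] of [q]. The lower bound [c]
    makes [Q] grow at least linearly in both directions, so [Q] is a bijection of the line and [P]
    exists for all times. *)
Lemma autonomous_ode (R : realType) (q : R -> R) (c : R) :
  0 < c -> continuous q -> (forall z, c <= q z) ->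
  exists P : R -> R, P 0 = 0 /\ forall s : R, is_derive s 1 P (q (P s))^-1.
Proof.
move=> c0 cq qc; have [Q' dQ'] := antiderivative cq.
pose Q z := Q' z - Q' 0.
have dQ (z : R) : is_derive z 1 Q (q z).
  by rewrite -[q z]subr0; apply: is_deriveB.
have cQ : continuous Q.
  move=> z; apply: differentiable_continuous; apply/derivable1_diffP.
  by have [] := dQ z.
have Qexp x y : x <= y -> c * (y - x) <= Q y - Q x.
  move=> xy; have [|w _ ->] := @MVT_segment R Q q x y xy (fun z _ => dQ z).
    exact: continuous_subspaceT.
  by rewrite ler_wpM2r// subr_ge0.
have Q0 : Q 0 = 0 by rewrite /Q subrr.
have Qinj : injective Q.
  move=> x y; wlog xy : x y / x <= y.
    by move=> H; have [/H//|/ltW/H + /esym] := leP x y; move=> /[apply].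
  move=> Qxy; have := Qexp _ _ xy; rewrite Qxy subrr pmulr_rle0// subr_le0 => yx.
  by apply/eqP; rewrite eq_le xy yx.
have Qsurj s : exists z, Q z = s.
  (* With this choice [Q (- M) <= s <= Q M], and the intermediate value theorem applies. *)
  pose M := `|s| / c.
  have M0 : 0 <= M by rewrite divr_ge0// ltW.
  have cM : c * M = `|s| by rewrite /M mulrCA divff ?gt_eqF// mulr1.
  have [|||z _ <-] := @IVT R Q (- M) M s; last by exists z.
  - by rewrite ge0_cp.
  - exact: continuous_subspaceT.
  - have := Qexp 0 M M0; rewrite Q0 !subr0 cM => h1.
    have := Qexp (- M) 0; rewrite oppr_le0 Q0 sub0r opprK add0r cM => /(_ M0) h2.
    have h3 := ler_norm s; have := ler_norm (- s); rewrite normrN => h4.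
    by rewrite ge_min le_max; apply/andP; split; apply/orP; [left|right]; lra.
have [P QP] := choice Qsurj.
have PQ : cancel Q P by move=> z; apply: Qinj; rewrite QP.
exists P; split; first by rewrite -Q0 PQ.
move=> s; rewrite -[s in is_derive s](QP s).
apply: (@is_derive_inverse _ Q P (q (P s)) (P s)).
- by near=> z; exact: PQ.
- by near=> z; exact: cQ.
- by rewrite gt_eqF// (lt_le_trans c0).
Unshelve. all: by end_near.
Qed.

(** By Caratheodory's criterion [f t = g t * t] with [g] continuous at 0, so [g] stays below
    [|g 0| + 1] near 0. *)
Lemma derivable_linear_bound (R : realType) (f : R -> R) (delta : R) : 
  0 < delta -> derivable f 0 1 -> f 0 = 0 ->
  exists b L : R, [/\ 0 < b < delta, 0 < L & forall t, 0 <= t <= b -> f t <= L * t].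
Proof.
move=> d0 /derivableP /is_derive1_caratheodory[g [fg cg gD]] f00.
pose L := `|g 0| + 1; have L0 : 0 < L by rewrite ltr_wpDl.
have /cvgr_lt/(_ L) : g @ (0 : R) --> g 0 by exact: cg.
rewrite /L ltr_pwDr// ?ler_norm// -/L => /(_ isT) /nbhs_ballP[e/= e0 gL].
exists (Num.min (delta / 2) (e / 2)), L; split=> // [|t /andP[t0]].
  by rewrite lt_min !divr_gt0//= gt_min ltr_pdivrMr// ltr_pMr// ltrDl ltr01.
rewrite le_min => /andP[_ te]; have := fg t; rewrite f00 !subr0 => ->.
rewrite ler_wpM2r// ltW// gL//; rewrite /ball/= sub0r normrN ger0_norm//.
by rewrite (le_lt_trans te)// ltr_pdivrMr// ltr_pMr// ltrDl ltr01.
Qed.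

(* Separation of variables for [ln (b / h)], which makes h positive by
   construction. The linear bound on f near 0 keeps the integrand away from 0,
   so that h is defined for all times. *)
Lemma decreasing_profile (R : realType) (f : R -> R) (delta : R) :
  0 < delta -> f 0 = 0 -> derivable f 0 1 ->
  (forall t, 0 < t < delta -> 0 < f t /\ {for t, continuous f}) ->
  exists h : R -> R, forall s, 0 < s ->
    0 < h s < delta /\ is_derive s 1 h (- f (h s)).
Proof.
move=> d0 f0 df fP.
have [b [L [/andP[b0 bd] L0 fL]]] := derivable_linear_bound d0 df f0.
(* [Num.max z 0] keeps [T z] in (0, b], where the hypotheses on [f] apply. *)
pose T (z : R) : R := b * expR (- Num.max z 0).
have T0 z : 0 < T z by rewrite mulr_gt0// expR_gt0.
have Tb z : T z <= b.
  by rewrite ler_piMr ?(ltW b0)// -expR0 ler_expR oppr_le0 le_max lexx orbT.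
have Td z : 0 < T z < delta by rewrite T0 (le_lt_trans (Tb z)).
have cT : continuous T.
  move=> z; apply: cvgM; first exact: cvg_cst.
  apply: continuous_cvg; first exact: continuous_expR.
  by apply: cvgN; apply: continuous_max => //; exact: cst_continuous.
(* For [h = b * expR (- z)] the equation [h' = - f h] becomes [z' = f h / h], which is [(q z)^-1]
   where [0 <= z]. *)
pose q (z : R) : R := T z / f (T z).
have qL z : L^-1 <= q z.
  have [fT _] := fP _ (Td z).
  by rewrite /q ler_pdivlMr// mulrC ler_pdivrMr// mulrC fL// Tb ltW.
have cq : continuous q.
  move=> z; have [fT cf] := fP _ (Td z).
  apply: cvgM; first exact: cT.
  apply: cvgV; first by rewrite gt_eqF.
  by apply: continuous_cvg => //; exact: cT.
have [|P [P0 dP]] := autonomous_ode _ cq qL; first by rewrite invr_gt0.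
exists (fun s => b * expR (- P s)) => s s0.
(* [P] starts at 0 with positive derivative, so the truncation in [T] is inactive at positive
   times. *)
have Ps : 0 < P s.
  have [|c _] := @MVT R P (fun s => (q (P s))^-1) 0 s s0 (fun x _ => dP x).
    apply: continuous_subspaceT => x; apply: differentiable_continuous.
    by apply/derivable1_diffP; have [] := dP x.
  rewrite P0 !subr0 => ->; rewrite mulr_gt0// invr_gt0 (lt_le_trans _ (qL _))//.
  by rewrite invr_gt0.
have TP : T (P s) = b * expR (- P s) by rewrite /T (max_idPl (ltW Ps)).
rewrite -TP; split=> //.
have [fT _] := fP _ (Td (P s)).
have -> : - f (T (P s)) = b * (expR (- P s) * - (q (P s))^-1).
  rewrite /q TP in fT *; have := expR_gt0 (- P s) => e0.
  by field; rewrite !gt_eqF.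
have dPs := dP s.
have dN : is_derive s 1 (fun s => - P s) (- (q (P s))^-1) by exact: is_deriveN.
have dE : is_derive s 1 (expR \o (fun s => - P s)) (expR (- P s) * - (q (P s))^-1).
  exact: is_derive1_comp.
exact: (is_deriveZ b dE).
Qed.

(** * Convexity of the profile and the family of its translates *)

Lemma derive1_ge0_homo (R : realType) (f : R -> R) (a b t : R) :
  t \in `]a, b[ -> {in `]a, b[ &, {homo f : x y / x <= y}} ->
  derivable f t 1 -> 0 <= f^`()%classic t.
Proof.
move=> tab fhomo df; rewrite derive1E /derive; apply: limr_ge => //.
have : \forall h \near (0 : R)^', h + t \in `]a, b[.
  have : {for (0 : R), continuous (fun h : R => h + t)}.
    by apply: (@continuousD R R R id (cst t) 0); [exact: cvg_id|exact: cst_continuous].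
  rewrite /prop_for /continuous_at add0r => ht.
  have h' := ht _ (near_in_itvoo tab).
  by apply: nbhs_dnbhs; exact: h'.
apply: filterS => h htab; rewrite [h%:A]mulr1.
have [h0|h0] := leP 0 h.
  by rewrite mulr_ge0 ?invr_ge0// subr_ge0 fhomo// lerDr.
by rewrite mulr_le0 ?invr_le0 ?(ltW h0)// subr_le0 fhomo// gerDr ltW.
Qed.

Lemma infinite_set_inj (T : Type) (A : set T) (F : nat -> T) :
  injective F -> (forall m, A (F m)) -> infinite_set A.
Proof.
move=> Finj FA; apply: (@sub_infinite_set _ (F @` setT)); first by move=> _ [m _ <-].
by rewrite (eq_finite_set (inj_card_eq (in2W Finj))); exact: infinite_nat.
Qed.

Lemma half_sqnorm_euclidean_norm (R : realType) (n : nat) (x : 'rV[R]_n) :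
  half_sqnorm x = euclidean_norm x ^+ 2 / 2.
Proof.
by rewrite /euclidean_norm sqr_sqrtr// sumr_ge0// => i _; exact: sqr_ge0.
Qed.

Theorem proposition2 (R : realType) (N k : nat) (f : R -> R)
  (hN : (2 <= N)%N) (hk : (1 <= k <= N - 1)%N)
  (hf : exists delta : R,
    [/\ 0 < delta,
        (forall t : R, - delta < t < delta -> derivable f t 1) /\
        (forall t : R, - delta < t < delta -> {for t, continuous f^`()%classic}),
        (forall s t : R, - delta < s < delta -> - delta < t < delta ->
           s <= t -> f s <= f t),
        (forall t : R, 0 < t < delta -> 0 < f t) &
        f 0 = 0]) :
  infinite_set [set u : 'rV[R]_N -> R |
    [/\ is_classical_solution k f u,
        is_radial u,
        is_bounded u &
        forall x, 0 < u x]].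
Proof.
have [delta [d0 [df cf'] fhomo fpos f0]] := hf.
have /andP[k0 kN] := hk.
have kgt0 : 0 < k%:R :> R by rewrite ltr0n.
have kneN : (k < N)%N by rewrite (leq_ltn_trans kN)// subn1 ltn_predL (leq_trans _ hN).
have inI t : 0 < t < delta -> - delta < t < delta.
  by move=> /andP[t0 ->]; rewrite andbT (lt_trans _ t0)// oppr_lt0.
have dfI t : 0 < t < delta -> is_derive t 1 f (f^`()%classic t).
  by move=> /inI /df /derivableP; rewrite derive1E.
have f'ge0 t : 0 < t < delta -> 0 <= f^`()%classic t.
  move=> td; apply: (@derive1_ge0_homo _ _ 0 delta); first by rewrite in_itv.
    by move=> x y; rewrite !in_itv/= => /inI xd /inI yd; exact: fhomo.
  exact: df (inI _ td).
have cfI t : 0 < t < delta -> {for t, continuous f}.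
  by move=> /dfI[ft _]; apply: differentiable_continuous; exact/derivable1_diffP.
(* The [k] smallest eigenvalues all equal [h'], so the equation reads [k%:R * h' + f h = 0]. *)
pose g t := f t / k%:R.
have df0 : derivable f 0 1 by apply: df; rewrite oppr_lt0 d0.
have [|||h hP] := @decreasing_profile R g delta d0.
- by rewrite /g f0 mul0r.
- by apply: derivableM => //; exact: derivable_cst.
- move=> t td; rewrite divr_gt0 ?fpos//; split=> //.
  by apply: (@continuousM R R f (fun=> k%:R^-1)); [exact: cfI|exact: cst_continuous].
have hd s : 0 < s -> 0 < h s < delta by move=> /hP[].
have dh (s : R) : 0 < s -> is_derive s 1 h (- g (h s)) by move=> /hP[].
pose h1 s := - g (h s).
(* This is [h'']: the chain rule gives [- f'(h) / k * h'], and [h' = - f(h) / k]. It is continuous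
   with [f] only of class C^1. *)
pose h2 s := f^`()%classic (h s) * f (h s) / k%:R ^+ 2.
have dh1 (s : R) : 0 < s -> is_derive s 1 h1 (h2 s).
  move=> s0; have dhs := dh s s0; have dfs := dfI _ (hd s s0).
  have dc : is_derive s 1 (f \o h) (f^`()%classic (h s) * - g (h s)).
    exact: is_derive1_comp.
  have -> : h2 s = - k%:R^-1 * (f^`()%classic (h s) * - g (h s)).
    by rewrite /h2 /g; field; rewrite gt_eqF.
  have -> : h1 = - k%:R^-1 \*: (f \o h).
    by apply/funext => z; rewrite /h1 /g /= mulrC -mulNr.
  exact: is_deriveZ.
have ch2 (s : R) : 0 < s -> {for s, continuous h2}.
  move=> s0; have ch : {for s, continuous h}.
    by apply: differentiable_continuous; apply/derivable1_diffP; case: (dh s s0).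
  apply: (@continuousM R R (fun s => f^`()%classic (h s) * f (h s)) (fun=> k%:R ^- 2));
    last exact: cst_continuous.
  apply: (@continuousM R R (fun s => f^`()%classic (h s)) (f \o h)).
    by apply: continuous_comp => //; exact: cf' (inI _ (hd s s0)).
  by apply: continuous_comp => //; exact: cfI (hd s s0).
(* Strict decrease will tell the translates apart. *)
have h_lt s t : 0 < s -> s < t -> h t < h s.
  move=> s0 st; rewrite -subr_lt0.
  have dst (x : R) : x \in `]s, t[ -> is_derive x 1 h (h1 x).
    by rewrite in_itv/= => /andP[sx _]; apply: dh; exact: lt_trans sx.
  have [|c] := MVT st dst.
    apply: derivable_within_continuous => x; rewrite in_itv/= => /andP[sx _].
    by have [] := dh x (lt_le_trans s0 sx).
  rewrite in_itv/= => /andP[sc _] ->; rewrite nmulr_rlt0 ?subr_gt0//.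
  by rewrite oppr_lt0 divr_gt0// fpos// hd// (lt_trans s0).
(* The shift is [m.+1] rather than [m]: [h] is controlled at positive times only, while
   [half_sqnorm] vanishes at the origin. *)
pose H (m : nat) s := h (s + m.+1%:R).
have sm s m : 0 <= s -> 0 < s + m.+1%:R :> R by move=> s0; rewrite ltr_wpDl.
have dshift (w dw : R -> R) m (s : R) : (forall s : R, 0 < s -> is_derive s 1 w (dw s)) ->
    0 <= s -> is_derive s 1 (fun s => w (s + m.+1%:R)) (dw (s + m.+1%:R)).
  move=> wP s0; have ds := wP _ (sm s m s0).
  have da : is_derive s 1 (fun s : R => s + m.+1%:R) 1.
    by apply: is_derive_eq; rewrite addr0.
  have : is_derive s 1 (w \o (fun s : R => s + m.+1%:R)) (dw (s + m.+1%:R) * 1).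
    exact: is_derive1_comp.
  by rewrite mulr1.
pose u m (x : 'rV[R]_N) := H m (half_sqnorm x).
apply: (@infinite_set_inj _ _ u).
  (* Two members of the family are compared at the origin, where they take the values of [h] at
     [m.+1] and [p.+1]. *)
  move=> m p /(congr1 (fun w => w 0)).
  have z0 : half_sqnorm (0 : 'rV[R]_N) = 0.
    by rewrite /half_sqnorm big1 ?mul0r// => j _; rewrite mxE expr0n.
  rewrite /u /H z0 !add0r.
  by case: (ltngtP m p) => // mp hmp; [have := @h_lt m.+1%:R p.+1%:R|
    have := @h_lt p.+1%:R m.+1%:R]; rewrite ltr0n ltr_nat ltnS hmp ltxx => /(_ isT mp).
move=> m.
have dH (s : R) : 0 <= s -> is_derive s 1 (H m) (h1 (s + m.+1%:R)).
  exact: dshift.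
have dH1 (s : R) : 0 <= s ->
    is_derive s 1 (fun s => h1 (s + m.+1%:R)) (h2 (s + m.+1%:R)) by exact: dshift.
have ud x : 0 < u m x < delta by apply: hd; apply: sm; exact: half_sqnorm_ge0.
split.
- split.
    have := @is_C2_comp_half_sqnorm R N _ _ _ dH dH1; apply=> s s0.
    by apply: (@continuous_comp R R R (fun s => s + m.+1%:R) h2);
      [apply: (@continuousD R R R id (cst _) s); [exact: cvg_id|exact: cst_continuous]|
       apply: ch2; exact: sm].
  move=> x; rewrite (hessian_comp_half_sqnorm dH dH1).
  rewrite truncated_laplacian_scalar_rank1//.
    by rewrite /h1 /g /u /H; field; rewrite gt_eqF.
  (* What remains is the convexity [0 <= h2], from [0 <= f'] and [0 < f] on the range of [h]. *)
  have hx := hd _ (sm _ m (half_sqnorm_ge0 x)).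
  by rewrite mulr_ge0 ?invr_ge0 ?exprn_ge0 ?ler0n// mulr_ge0 ?f'ge0// ltW// fpos.
- exists (fun r => H m (r ^+ 2 / 2)) => x.
  by rewrite -half_sqnorm_euclidean_norm.
- by exists delta => x; have /andP[u0 ul] := ud x; rewrite gtr0_norm// ltW.
- by move=> x; have /andP[] := ud x.
Qed.
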